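(* Let $(X,d_X)$ and $(Y,d_Y)$ be metric spaces and $f:X\to Y$ a continuous function on $X$. Suppose there exist $p,x\in X$ such that $\beta:=d_Y(f(x),f(p))>0$ and there exists a path in $X$ connecting $p$ and $x$. Then for every $\epsilon$ with $0<\epsilon\leq\beta$ we have $f^{-1}(S[f(p),\epsilon])\neq\emptyset$ and $f^{-1}(S[f(x),\epsilon])\neq\emptyset$. In particular, for every $\epsilon$ with $0<\epsilon\leq\beta$, the numbers $\delta(p,\epsilon)=\mathrm{dist}(p,f^{-1}(S[f(p),\epsilon]))$ and $\delta(x,\epsilon)=\mathrm{dist}(x,f^{-1}(S[f(x),\epsilon]))$ are well defined and positive.
   Context: For $y_0\in Y$ and $\epsilon>0$, $S[y_0,\epsilon]=\{y\in Y: d_Y(y_0,y)=\epsilon\}$ is the sphere. For a nonempty set $A\subset X$ and $q\in X$, $\mathrm{dist}(q,A)=\inf\{d_X(q,z): z\in A\}$. A path connecting $p$ and $x$ is a continuous map $\gamma:[0,1]\to X$ with $\gamma(0)=p$, $\gamma(1)=x$. *)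

(* Defs.v *)
From HB Require Import structures.
From mathcomp Require Import all_boot all_order all_algebra.
From mathcomp Require Import all_classical all_reals all_analysis.

Set Implicit Arguments.
Unset Strict Implicit.
Unset Printing Implicit Defensive.

Import Order.TTheory GRing.Theory Num.Theory.
Import numFieldNormedType.Exports.

Local Open Scope classical_set_scope.
Local Open Scope ring_scope.

Definition sphere (R : realType) (Y : metricType R) (y0 : Y) (eps : R) : set Y :=
  [set y | mdist y0 y = eps].

Definition distances (R : realType) (X : metricType R) (q : X) (A : set X) : set R :=
  [set mdist q z | z in A].

(* [inf] is total, with value 0 on sets without an infimum: this is the
   distance to [A] only when [has_inf (distances q A)], i.e. for nonempty [A]. *)
Definition dist (R : realType) (X : metricType R) (q : X) (A : set X) : R :=
  inf (distances q A).

(* Only the restriction of [gamma] to [0, 1], with the subspace topology,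
   is constrained; its values elsewhere are irrelevant. *)
Definition is_path (R : realType) (X : metricType R) (p x : X) (gamma : R -> X) : Prop :=
  [/\ {within `[0, 1], continuous gamma}, gamma 0 = p & gamma 1 = x].

Definition delta (R : realType) (X Y : metricType R) (f : X -> Y)
    (q : X) (eps : R) : R :=
  dist q (f @^-1` sphere (f q) eps).

(* Main.v *)
Require Import Defs.
From HB Require Import structures.
From mathcomp Require Import all_boot all_order all_algebra.
From mathcomp Require Import all_classical all_reals all_analysis.
From mathcomp Require Import lra.

Set Implicit Arguments.
Unset Strict Implicit.
Unset Printing Implicit Defensive.

Import Order.TTheory GRing.Theory Num.Theory.
Import numFieldNormedType.Exports.

Local Open Scope classical_set_scope.
Local Open Scope ring_scope.

(** The distance to a fixed point is continuous, so along a path from [p] to [x]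
the distance of [f] to [f p] (resp. to [f x]) varies continuously between [0] and
[mdist (f x) (f p)], and by the intermediate value theorem it takes every value
[eps] in between ([path_meets_preimage_sphere]). The infimum defining [delta] is positive
because, by continuity of [f] at [q], a whole ball around [q] is mapped into the
open ball of radius [eps] around [f q], hence misses the preimage of the
sphere ([delta_gt0]). *)

Lemma mdist_continuous (R : realType) (Y : metricType R) (y0 : Y) :
  continuous (fun y : Y => mdist y0 y : R).
Proof.
move=> y; apply/cvgrPdist_lt => e e0.
near=> z.
have yz : mdist y z < e.
  near: z; exact: (metricType_numDomainType.cvgr_dist_lt cvg_id).
(* The reverse triangle inequality, both ways. *)
have := metric_triangle y0 y z; have := metric_triangle y0 z y.
rewrite (metric_sym z y) ltr_distl => h1 h2; apply/andP; split; lra.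
Unshelve. all: by end_near. Qed.

(** The base point [q] is arbitrary: for the theorem, [q] is one of the two
endpoints of the path, so that one of the two values in the bracketing
hypothesis is [0]. *)
Lemma path_meets_preimage_sphere (R : realType) (X Y : metricType R)
    (f : X -> Y) (p x q : X) (gamma : R -> X) (eps : R) :
  continuous f -> Defs.is_path p x gamma ->
  Num.min (mdist (f q) (f p)) (mdist (f q) (f x)) <= eps
    <= Num.max (mdist (f q) (f p)) (mdist (f q) (f x)) ->
  f @^-1` Defs.sphere (f q) eps !=set0.
Proof.
move=> cf [cgamma gamma0 gamma1] eps_between.
have [t _ gteps] : exists2 t, t \in `[0, 1]%R &
    mdist (f q) (f (gamma t)) = eps.
  apply: IVT; rewrite ?ler01 ?gamma0 ?gamma1 //.
  have cdist : continuous (fun z : X => mdist (f q) (f z)).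
    move=> z; apply: (@continuous_comp X Y R f (mdist (f q))); first exact: cf.
    exact: mdist_continuous.
  move=> t; exact:
    (cvg_comp gamma (fun z => mdist (f q) (f z)) (cgamma t) (cdist _)).
by exists (gamma t).
Qed.

Lemma has_inf_distances (R : realType) (X : metricType R) (q : X) (A : set X) :
  A !=set0 -> has_inf (Defs.distances q A).
Proof.
move=> [z Az]; split; first by exists (mdist q z); exists z.
by exists 0 => _ [y _ <-]; exact: mdist_ge0.
Qed.

Lemma delta_gt0 (R : realType) (X Y : metricType R) (f : X -> Y) (q : X)
    (eps : R) :
  {for q, continuous f} -> 0 < eps ->
  f @^-1` Defs.sphere (f q) eps !=set0 -> 0 < Defs.delta f q eps.
Proof.
move=> cf eps0 /(has_inf_distances q)[nonempty _].
have near_q : \forall z \near q, mdist (f q) (f z) < eps.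
  exact: (metricType_numDomainType.cvgr_dist_lt cf).
have /nbhs_ballP[d /= d0 ball_sub] := near_q.
apply: lt_le_trans d0 _; apply: lb_le_inf => // _ [z fz <-].
rewrite leNgt; apply/negP => zd.
have /ball_sub /= : ball q d z by rewrite ballEmdist.
by rewrite fz ltxx.
Qed.

Theorem corollary1 (R : realType) (X Y : metricType R) (f : X -> Y)
    (hf : continuous f) (p x : X)
    (hbeta : 0 < mdist (f x) (f p))
    (hpath : exists gamma : R -> X, Defs.is_path p x gamma) :
  (forall eps : R, 0 < eps -> eps <= mdist (f x) (f p) ->
     f @^-1` Defs.sphere (f p) eps !=set0 /\
     f @^-1` Defs.sphere (f x) eps !=set0) /\
  (forall eps : R, 0 < eps -> eps <= mdist (f x) (f p) ->
     [/\ has_inf (Defs.distances p (f @^-1` Defs.sphere (f p) eps)),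
         0 < Defs.delta f p eps,
         has_inf (Defs.distances x (f @^-1` Defs.sphere (f x) eps)) &
         0 < Defs.delta f x eps]).
Proof.
have [gamma path_gamma] := hpath.
have preim eps : 0 < eps -> eps <= mdist (f x) (f p) ->
    f @^-1` Defs.sphere (f p) eps !=set0 /\
    f @^-1` Defs.sphere (f x) eps !=set0.
  move=> eps0 eps_le; split; apply: (path_meets_preimage_sphere hf path_gamma);
    rewrite ge_min le_max mdistxx (ltW eps0) ?orbT //=.
    by rewrite metric_sym eps_le orbT.
  by rewrite eps_le.
split=> // eps eps0 eps_le; have [Sp Sx] := preim _ eps0 eps_le.
by split; [exact: has_inf_distances|apply: delta_gt0 => //; exact: hf
          |exact: has_inf_distances|apply: delta_gt0 => //; exact: hf].
Qed.
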